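(* Let $Q$ be a left cancellative, $k$-translatable semigroup of order $n$. Let $m$ be the smallest positive integer such that $[mk]_n=0$ and let $t$ be the smallest positive integer such that $[tm]_n=0$. Then $Q$ is a union of $t$ pairwise disjoint copies of cyclic groups of order $m$ (that is, $Q$ is a disjoint union of $t$ subsemigroups, each of which is a cyclic group of order $m$).
   Context: A groupoid is a set with a binary operation $\cdot$; a semigroup is an associative groupoid. It is left cancellative if $x\cdot y=x\cdot z$ implies $y=z$. For an integer $x$, $[x]_n$ denotes the residue of $x$ modulo $n$, represented in $\{1,\ldots,n\}$, with $0$ identified with $n$; $[x]_n=0$ means $n\mid x$. All groupoids are finite and taken to be of the form $Q=\{1,\ldots,n\}$ with the natural ordering. For $1\le k<n$, $Q$ is $k$-translatable if in its multiplication table each row $i$, $2\le i\le n$, is obtained from row $i-1$ by cyclically shifting it $k$ places to the right, i.e. $i\cdot j=(i-1)\cdot[j-k]_n$ for all $j$ and all $2\le i\le n$. *)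

(* Defs.v *)
From mathcomp Require Import all_boot all_fingroup all_solvable.
Set Implicit Arguments.
Unset Strict Implicit.
Unset Printing Implicit Defensive.

(* A groupoid on Q = {1, ..., n} is a binary operation on 'I_n, where the
   ordinal i (with 0 <= i < n) stands for the element i + 1 of Q. *)

Definition left_cancellative (T : Type) (op : T -> T -> T) : Prop :=
  forall x y z : T, op x y = op x z -> y = z.

(* Row i equals row i' = i - 1 shifted k places to the right.  The hypothesis
   i = i'.+1 excludes the first row only, and j' is [j - k]_n: both sides of
   the congruence carry the same offset 1 between ordinals and elements of Q. *)
Definition translatable (n k : nat) (op : 'I_n -> 'I_n -> 'I_n) : Prop :=
  forall i i' j j' : 'I_n,
    i = i'.+1 :> nat -> j' + k = j %[mod n] -> op i j = op i' j'.

Definition least_positive (P : pred nat) (m : nat) : Prop :=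
  [/\ 0 < m, P m & forall m' : nat, 0 < m' -> P m' -> m <= m'].

(* H is the image of a cyclic group of order m under an injective map that
   turns the group law into op; in particular H is closed under op. *)
Definition cyclic_group_copy (T : finType) (op : T -> T -> T) (m : nat)
    (H : {set T}) : Prop :=
  exists (gT : finGroupType) (G : {group gT}) (f : gT -> T),
    [/\ cyclic G, #|G| = m, {in G &, injective f}, f @: G = H
      & {in G &, {morph f : x y / (x * y)%g >-> op x y}}].

(* Main.v *)
Require Import Defs.
From mathcomp Require Import all_boot all_fingroup all_solvable.
From mathcomp Require Import ssralg finalg zmodp ring.

Set Implicit Arguments.
Unset Strict Implicit.
Unset Printing Implicit Defensive.

(** Translatability says that the whole table is determined by its first row
    [a]: modulo [n], the product [i j] is [a (j - k i)], and left cancellation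
    makes [a] injective.  Cancelling [a] in the associative law forces [a] to
    be a translation, so that [i j = j - k i + c] where [k c = - c] and
    [k^2 = - k] modulo [n] ([translated_assoc_affine]).

    On the subgroup [K] of Z/n generated by [k], multiplication by [- k] is
    therefore the identity, and for any idempotent [e], i.e. any [e] with
    [k e = c], the map [x |-> e + x] turns addition on [K] into the product:
    [(e + x) (e + y) = e + y - (c + k x) + c = e + (x + y)].  Every coset
    [K + r] contains such an [e], namely [(1 + k) r - c], since
    [k (1 + k) = 0] and [c = k (- c)] lies in [K]; so every coset of [K] is a
    copy of the cyclic group [K].  Finally [K] has order [m], because [m] is
    the additive order of [k], and hence index [n / m = t]. *)

Import GRing.Theory.
Local Open Scope ring_scope.

Section Affine.

Variables (R : comPzRingType) (k : R) (a : R -> R) (op : R -> R -> R).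
Hypothesis opE : forall i j, op i j = a (j - k * i).

(** After cancelling [a], associativity reads
    [l - k a(j - k i) = a(l - k j) - k i].  At [i = j = 0] this shows that [a]
    is a translation, by [- k a(0)], which evaluation at [0] identifies with
    [a(0)]; at [i = 1], [j = l = 0] it then reads [k^2 = - k]. *)
Lemma translated_assoc_affine :
    injective a -> associative op ->
  [/\ forall x, a x = x + a 0, k * a 0 = - a 0 & k * k = - k].
Proof.
move=> a_inj opA.
have assoc_a i j l : a (l - k * j) - k * i = l - k * a (j - k * i).
  by apply: a_inj; have := opA i j l; rewrite !opE.
have a_shift x : a x = x - k * a 0.
  by have := assoc_a 0 0 x; rewrite !mulr0 !subr0.
have kc : k * a 0 = - a 0 by rewrite [in RHS]a_shift sub0r opprK.
have aE x : a x = x + a 0 by rewrite a_shift kc opprK.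
split=> //; have := assoc_a 1 0 0.
rewrite !mulr0 !mulr1 subr0 !sub0r (aE (- k)) mulrDr kc mulrN => E.
by apply: (addIr (a 0)); rewrite [RHS]addrC E; ring.
Qed.

End Affine.

Section Zn.

Variables (p k : nat) (op : 'I_p.+2 -> 'I_p.+2 -> 'I_p.+2).

(** Induction on the row number: each step down shifts the columns by [k]. *)
Lemma translatableE :
  translatable k op -> forall i j, op i j = op 0 (j - k%:R * i).
Proof.
move=> op_tr i j; rewrite -[i in RHS]natr_Zp.
case: i => i; rewrite /=; elim: i j => [|i IHi] j lt_ip.
  by rewrite mulr0 subr0; congr (op _ j); apply: val_inj.
rewrite (op_tr _ (Ordinal (ltnW lt_ip)) _ (j - k%:R)) //.
  by rewrite IHi; congr (op 0 _); rewrite -natr1; ring.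
have /(congr1 val) /= : j - k%:R + k%:R = j by rewrite subrK.
by rewrite Zp_nat /= modnDmr => ->; rewrite modn_small.
Qed.

(** The condition [n | x k] says that [x] annihilates [k] in Z/n, so its least
    positive solution is the order of [k] in the additive group. *)
Lemma order_least_positive m :
  least_positive (fun x => p.+2 %| x * k)%N m -> #[k%:R : 'I_p.+2]%g = m.
Proof.
have ordE x : (#[k%:R : 'I_p.+2]%g %| x)%N = (p.+2 %| x * k)%N.
  rewrite order_dvdn FinRing.zmodXgE -mulrnA mulnC Zp_nat.
  by rewrite -val_eqE.
case=> m_gt0 dvd_m min_m; apply/eqP; rewrite eqn_leq min_m ?order_gt0 //.
  by rewrite dvdn_leq // ordE.
by rewrite -ordE.
Qed.

Variable c : 'I_p.+2.
Hypotheses (opE : forall i j, op i j = j - k%:R * i + c)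
  (kc : k%:R * c = - c) (kk : k%:R * k%:R = - k%:R :> 'I_p.+2).

Let K : {group 'I_p.+2} := <[k%:R : 'I_p.+2]>%G.

Lemma mulk_mem (x : 'I_p.+2) : k%:R * x \in K.
Proof.
by rewrite -[x]natr_Zp mulr_natr -FinRing.zmodXgE mem_cycle.
Qed.

(** Elements of [K] are multiples of [k], and [k^2 = - k]: this is what turns
    [y - k x] into [x + y] inside [K]. *)
Lemma mulk_opp x : x \in K -> k%:R * x = - x.
Proof.
case/cycleP=> i ->.
by rewrite FinRing.zmodXgE -[_ *+ i]mulr_natr mulrA kk mulNr.
Qed.

(** Addition on [K], translated to the idempotent [e] of the coset, is the
    product: [(e + x) (e + y) = e + y - k e - k x + c], where [k e = c] and
    [- k x = x]. *)
Lemma rcoset_cyclic_copy r : cyclic_group_copy op #|K| (K :* r)%g.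
Proof.
pose e : 'I_p.+2 := (1 + k%:R) * r - c.
have ke : k%:R * e = c.
  rewrite /e mulrBr kc mulrA mulrDr kk mulr1 addrN mul0r; ring.
exists 'I_p.+2, K, (fun x => e + x); split=> //.
- exact: cycle_cyclic.
- by move=> x y _ _ /addrI.
- have er : e - r \in K.
    (* As c = - k c, the difference k r - c is k (r + c). *)
    have -> : e - r = k%:R * (r + c) by rewrite mulrDr kc /e; ring.
    exact: mulk_mem.
  apply/setP=> z; rewrite mem_rcoset FinRing.zmodMgE FinRing.zmodVgE.
  apply/imsetP/idP => [[x Kx ->]|Kz].
    have -> : e + x - r = e - r + x by ring.
    by have := groupM er Kx; rewrite FinRing.zmodMgE.
  exists (z - e); last by ring.
  have -> : z - e = z - r - (e - r) by ring.
  by have := groupM Kz (groupVr er); rewrite FinRing.zmodMgE FinRing.zmodVgE.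
- move=> x y Kx _; rewrite opE FinRing.zmodMgE mulrDr ke mulk_opp //; ring.
Qed.

End Zn.

Local Close Scope ring_scope.

Lemma least_positive_quotient n m t :
  0 < n -> m %| n -> least_positive (fun x => n %| x * m) t -> t = n %/ m.
Proof.
move=> n_gt0 m_n [t_gt0 dvd_t min_t].
have m_gt0 : 0 < m by apply: dvdn_gt0 m_n.
apply/eqP; rewrite eqn_leq; apply/andP; split.
  apply: min_t; first by rewrite divn_gt0 // dvdn_leq.
  by rewrite /= divnK.
by rewrite leq_divLR // dvdn_leq // muln_gt0 t_gt0.
Qed.

Theorem theorem5p15 (n k : nat) (op : 'I_n -> 'I_n -> 'I_n) (m t : nat)
  (hk : 1 <= k < n)
  (hassoc : associative op)
  (hcancel : left_cancellative op)
  (htrans : translatable k op)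
  (hm : least_positive (fun x => n %| x * k) m)
  (ht : least_positive (fun x => n %| x * m) t) :
  exists P : {set {set 'I_n}},
    [/\ partition P [set: 'I_n], #|P| = t
      & forall H : {set 'I_n}, H \in P -> cyclic_group_copy op m H].
Proof.
case: n op hk hassoc hcancel htrans hm ht => [|[|p]] op hk hassoc hcancel.
- by case/andP: hk.
- by case: k hk => [|[|?]].
move=> htrans hm ht.
have opE := translatableE htrans.
have [aE kc kk] := translated_assoc_affine opE (@hcancel _) hassoc.
have {aE} opE' i j : op i j = (j - k%:R * i + op 0 0)%R by rewrite opE aE.
pose K := <[(k%:R)%R : 'I_p.+2]>%G.
have cardK : #|K| = m := order_least_positive hm.
have KT : K \subset [set: 'I_p.+2]%G := subsetT _.
exists (rcosets K [set: 'I_p.+2]); split.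
- exact: rcosets_partition KT.
- have m_n : m %| p.+2 by rewrite -cardK -[p.+2]card_ord -cardsT cardSg.
  rewrite (least_positive_quotient _ m_n ht) // -cardK.
  by rewrite -[LHS]/(#|[set: 'I_p.+2] : K|%g) -divgS // cardsT card_ord.
- move=> H /rcosetsP[r _ ->]; rewrite -cardK.
  exact: rcoset_cyclic_copy opE' kc kk r.
Qed.
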